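(* For every $t\ge 0$ and $r\ge 0$, $$-\frac{\partial W}{\partial t}(t,r)=\mathcal J_{0,1}(t,r)-t^2\mathcal J_{0,3}(t,r)+rt\,\mathcal J_{1,2}(t,r),\qquad \frac{\partial W}{\partial r}(t,r)=-t^2\mathcal J_{1,2}(t,r)+rt\,\mathcal J_{0,1}(t,r),$$ where, for nonnegative integers $j,n$, $$\mathcal J_{j,n}(t,r)=\int_0^1\exp\left(-\frac{(r-t+t\xi)^2}{2}\right)\tilde I_j\bigl(rt(1-\xi)\bigr)\frac{(1-\xi)^n}{\sqrt{\xi}\,\sqrt{2-\xi}}\,d\xi .$$ That is, the right-hand sides are the pressure and radial velocity pulsations $p'=-\partial W/\partial t$, $u_r'=\partial W/\partial r$ corresponding to the wave potential $W$.
   Context: $\tilde I_j(x)=e^{-x}I_j(x)$, where $I_j$ is the modified Bessel function of the first kind of index $j$. $W=W(t,r)$, with $r=|\mathbf r|$, $\mathbf r\in\mathbb R^2$, denotes the wave potential: the radially symmetric classical solution of the two-dimensional wave equation in $\mathbb R^2$ for $t\geq 0$, which in the radial variable is the Cauchy problem $$\frac{\partial^2 W}{\partial t^2}-\frac1r\frac{\partial}{\partial r}\left(r\frac{\partial W}{\partial r}\right)=0,\quad t>0,\ r>0,\qquad W|_{t=0}=0,\quad \frac{\partial W}{\partial t}\Big|_{t=0}=-\exp\left(-\frac{r^2}{2}\right).$$ The pressure and velocity pulsations are $p'(t,\mathbf r)=-\frac{\partial W}{\partial t}(t,r)$ and $\mathbf u'(t,\mathbf r)=u_r'(t,r)\,\mathbf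 r/r$ with $u_r'(t,r)=\frac{\partial W}{\partial r}(t,r)$. At $r=0$ the derivative $\partial W/\partial r$ is the one-sided derivative. *)

(* Defs.v *)
From Stdlib Require Import Reals Factorial.
From Coquelicot Require Import Coquelicot.
Open Scope R_scope.

(** ** Modified Bessel functions and the integrals [J] *)

Definition besselI (j : nat) (x : R) : R :=
  Series (fun m => (x / 2) ^ (2 * m + j) / (INR (fact m) * INR (fact (m + j)))).

Definition besselI_scaled (j : nat) (x : R) : R := exp (- x) * besselI j x.

(** The integrand is singular at [xi = 0], so the integral is improper there. *)
Definition J (j n : nat) (t r : R) : R :=
  RInt_gen
    (fun xi => exp (- ((r - t + t * xi) ^ 2 / 2)) *
               besselI_scaled j (r * t * (1 - xi)) *
               ((1 - xi) ^ n / (sqrt xi * sqrt (2 - xi))))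
    (at_right 0) (at_point 1).

(** ** Derivatives relative to a set *)

(** The limit of the difference quotient is taken along points of [D] only, so
    that this is a one-sided derivative at an endpoint of an interval [D] and
    the ordinary derivative at its interior points. *)
Definition is_derive_within (D : R -> Prop) (f : R -> R) (x l : R) : Prop :=
  filterdiff f (within D (locally x)) (fun h => scal h l).

(** A point of space-time is [(t, (x, y))]. *)
Definition point : Type := (R * (R * R))%type.

Inductive coord : Set := T | X | Y.

Definition shift (i : coord) (p : point) (h : R) : point :=
  let '(t, (x, y)) := p in
  match i with
  | T => (t + h, (x, y))
  | X => (t, (x + h, y))
  | Y => (t, (x, y + h))
  end.

Definition is_partial_within (D : point -> Prop) (i : coord)
    (u : point -> R) (p : point) (l : R) : Prop :=
  is_derive_within (fun h => D (shift i p h)) (fun h => u (shift i p h)) 0 l.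

(** [u] is of class C^1 on [D], with partial derivatives [du i]. *)
Definition C1_on (D : point -> Prop) (u : point -> R)
    (du : coord -> point -> R) : Prop :=
  continuous_on D u /\
  forall i, continuous_on D (du i) /\
            forall p, D p -> is_partial_within D i u p (du i p).

(** ** The wave equation in the plane *)

(** Classical solution of [u_tt = u_xx + u_yy], [u = f] and [u_t = g] at
    [t = 0]: [u] is C^1 on the closed half-space [t >= 0], where the initial
    data are attained, and C^2 on the open one, where the equation holds. *)
Definition classical_wave_solution (f g : R -> R -> R) (u : point -> R) : Prop :=
  exists (du : coord -> point -> R) (ddu : coord -> coord -> point -> R),
    C1_on (fun p => 0 <= fst p) u du /\
    (forall i, C1_on (fun p => 0 < fst p) (du i) (ddu i)) /\
    (forall p, 0 < fst p -> ddu T T p = ddu X X p + ddu Y Y p) /\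
    (forall x y, u (0, (x, y)) = f x y) /\
    (forall x y, du T (0, (x, y)) = g x y).

(** Only the values [W t r] with [r >= 0] occur here. *)
Definition radial (W : R -> R -> R) (p : point) : R :=
  let '(t, (x, y)) := p in W t (sqrt (x ^ 2 + y ^ 2)).

Definition wave_potential (W : R -> R -> R) : Prop :=
  classical_wave_solution
    (fun _ _ => 0)
    (fun x y => - exp (- ((x ^ 2 + y ^ 2) / 2)))
    (radial W).

(** ** Pulsations *)

Definition is_pressure_pulsation (W : R -> R -> R) (t r p : R) : Prop :=
  is_derive_within (fun s => 0 <= s) (fun s => W s r) t (- p).

Definition is_radial_velocity_pulsation (W : R -> R -> R) (t r v : R) : Prop :=
  is_derive_within (fun s => 0 <= s) (fun s => W t s) r v.

(* Main.v *)
Require Import Defs.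
From Stdlib Require Import Reals Factorial Lra Lia Classical.
From Coquelicot Require Import Coquelicot.
Open Scope R_scope.

(** Poisson's formula, with the initial pulse averaged over circles, gives the
    candidate [- t * J 0 1 t r] for the wave potential; differentiating it
    under the integral sign gives the right-hand sides, the first one up to its
    sign.  These derivatives, not the candidate itself, are compared with those
    of [W].  For a radial solution, [p = dW/dt] and [q = dW/dr] satisfy the
    first-order system [p_t = q_r + q / r], [q_t = p_r] for [t > 0], and so do
    the derivatives of the candidate, with the same values at [t = 0].
    Uniqueness for this system identifies them.

    Uniqueness comes from the energy identity
    [(r (p^2 + q^2))_t = (2 r p q)_r].  The flux [2 r p q] is bounded by the
    density [r (p^2 + q^2)], so the energy in the shrinking interval
    [[0, R - t]] does not increase, and it starts from zero
    ([conserved_density_zero], [acoustic_unique]).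

    On the explicit side, [1 - xi = cos phi] removes the singularity, and
    [I_j x = (x / 2)^j B_j (x^2 / 4)] with an entire [B_j] removes the parity
    of the Bessel functions.  All integrals become multiples of
    [arc_int j n], which integrates
    [exp (- (r^2 + t^2 c^2) / 2) B_j (r^2 t^2 c^2 / 4) c^n], [c = cos phi], over
    [0 <= phi <= pi / 2] ([J_arc_int]).  This family is closed under both partial
    derivatives; the recurrence of the Bessel functions
    ([arc_int_recurrence]) and an integration by parts in [phi]
    ([arc_int_by_parts]) then turn the first equation of the system into an
    algebraic identity ([is_derive_wave_r_r]).

    On the side of the given solution, restriction to the axis [y = 0] turns
    the Cartesian derivatives into radial ones: [u_yy] is [q / r] there, and
    [p_r = q_t] is the equality of mixed derivatives
    ([wave_potential_acoustic]). *)

(** * Entire Bessel series *)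

Definition bess_coef (j m : nat) : R := / (INR (fact m) * INR (fact (m + j))).

(** The entire function [B_j] with [I_j x = (x / 2)^j B_j (x^2 / 4)]. *)
Definition bess (j : nat) : R -> R := PSeries (bess_coef j).

Lemma bess_coef_step (j m : nat) :
  bess_coef j (S m) = bess_coef j m * / (INR (S m) * INR (S (m + j))).
Proof.
  unfold bess_coef. change (S m + j)%nat with (S (m + j)).
  rewrite !fact_simpl, !mult_INR.
  field. repeat split; try apply INR_fact_neq_0; apply not_0_INR; lia.
Qed.

Lemma bess_CV_radius (j : nat) : CV_radius (bess_coef j) = p_infty.
Proof.
  assert (Hnz : forall m, bess_coef j m <> 0).
  { intros m. apply Rinv_neq_0_compat, Rmult_integral_contrapositive_currified;
      apply INR_fact_neq_0. }
  apply CV_radius_infinite_DAlembert; [exact Hnz|].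
  apply is_lim_seq_le_le with (u := fun _ => 0) (w := fun m => / INR (S m)).
  - intros m. split; [apply Rabs_pos|].
    replace (bess_coef j (S m) / bess_coef j m) with (/ INR (S m) * / INR (S (m + j))).
    + assert (H1 : 0 < INR (S m)) by (apply lt_0_INR; lia).
      assert (H2 : 1 <= INR (S (m + j))) by (apply (le_INR 1); lia).
      apply Rinv_0_lt_compat in H1.
      assert (H3 : 0 < / INR (S (m + j))) by (apply Rinv_0_lt_compat; lra).
      assert (H4 : / INR (S (m + j)) <= 1).
      { rewrite <- Rinv_1. apply Rinv_le_contravar; lra. }
      rewrite Rabs_pos_eq; nra.
    + rewrite bess_coef_step. field. repeat split; try apply Hnz; apply not_0_INR; lia.
  - apply is_lim_seq_const.
  - apply (is_lim_seq_inv _ p_infty); [|discriminate].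
    apply (is_lim_seq_incr_1 INR). apply is_lim_seq_INR.
Qed.

Lemma is_derive_bess (j : nat) (z : R) : is_derive (bess j) z (bess (S j) z).
Proof.
  replace (bess (S j) z) with (PSeries (PS_derive (bess_coef j)) z).
  - apply is_derive_PSeries. rewrite bess_CV_radius. exact I.
  - apply PSeries_ext. intros m. unfold PS_derive, bess_coef.
    replace (m + S j)%nat with (S (m + j)) by lia.
    change (S m + j)%nat with (S (m + j)). rewrite !fact_simpl, !mult_INR.
    field. repeat split; try apply INR_fact_neq_0; apply not_0_INR; lia.
Qed.

(** With [z = x^2 / 4] this is [I_0 x - I_2 x = 2 I_1 x / x]. *)
Lemma bess_recurrence (z : R) : z * bess 2 z = bess 0 z - bess 1 z.
Proof.
  unfold bess. rewrite <- PSeries_incr_1.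
  rewrite <- PSeries_minus.
  - apply PSeries_ext. intros [|m].
    + unfold PS_incr_1, PS_minus, PS_plus, PS_opp, bess_coef. simpl.
      unfold zero, plus, opp; simpl. field.
    + unfold PS_incr_1, PS_minus, PS_plus, PS_opp, bess_coef.
      unfold plus, opp; simpl plus. cbn -[fact INR Nat.add].
      replace (m + 2)%nat with (S (S m)) by lia.
      replace (S m + 0)%nat with (S m) by lia.
      replace (S m + 1)%nat with (S (S m)) by lia.
      rewrite !fact_simpl, !mult_INR, !S_INR.
      field. pose proof (pos_INR m).
      repeat split; try apply INR_fact_neq_0; lra.
  - apply CV_radius_inside. rewrite bess_CV_radius. exact I.
  - apply CV_radius_inside. rewrite bess_CV_radius. exact I.
Qed.

Lemma besselI_bess (j : nat) (x : R) :
  besselI j x = (x / 2) ^ j * bess j (x ^ 2 / 4).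
Proof.
  unfold besselI, bess, PSeries. rewrite <- Series_scal_l.
  apply Series_ext. intros m. unfold bess_coef.
  rewrite pow_add, pow_mult. replace ((x / 2) ^ 2) with (x ^ 2 / 4) by field.
  unfold Rdiv. ring.
Qed.

(** * Integrals depending on parameters *)

(** Compactness of a segment, in the form of a tube lemma: a property which
    holds eventually near each point holds eventually on the whole segment.
    Stating it for an arbitrary filter serves both the continuity of
    parametric integrals and the uniform limit as [t -> 0+]. *)
Lemma filter_forall_segment {U : Type} (F : (U -> Prop) -> Prop) {FF : Filter F}
    (Q : U -> R -> Prop) (a b : R) :
  a <= b ->
  (forall x, a <= x <= b ->
     filter_prod F (locally x) (fun p => Q (fst p) (snd p))) ->
  F (fun u => forall x, a <= x <= b -> Q u x).
Proof.
  intros Hab H.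
  set (E := fun x => a <= x <= b /\ F (fun u => forall y, a <= y <= x -> Q u y)).
  assert (HE : E a).
  { split; [lra|]. destruct (H a) as [A V HA HV HQ]; [lra|].
    apply (filter_imp A); [|exact HA].
    intros u Hu y Hy. replace y with a by lra.
    apply (HQ u a Hu), (locally_singleton _ _ HV). }
  destruct (completeness E) as [c [Hub Hlub]].
  { exists b. intros x [Hx _]. lra. }
  { exists a. exact HE. }
  assert (Hac : a <= c) by (apply Hub, HE).
  assert (Hcb : c <= b) by (apply Hlub; intros x [Hx _]; lra).
  destruct (H c) as [A V HA [d HV] HQ]; [lra|].
  assert (Hx : exists x, E x /\ c - d < x).
  { apply NNPP. intros Hn. assert (c <= c - d); [|pose proof (cond_pos d); lra].
    apply Hlub. intros x Hx. apply Rnot_lt_le. intros Hlt. apply Hn.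
    exists x. split; assumption. }
  destruct Hx as [x [[Hx HFx] Hcx]].
  assert (HF : F (fun u => forall y, a <= y <= Rmin b (c + d / 2) -> Q u y)).
  { apply (filter_imp (fun u => A u /\ forall y, a <= y <= x -> Q u y));
      [|apply filter_and; assumption].
    intros u [Hu Hux] y [Hy1 Hy2].
    destruct (Rle_dec y x) as [Hyx|Hyx]; [apply Hux; lra|].
    apply (HQ u y Hu). apply HV. unfold ball; simpl.
    unfold AbsRing_ball, abs, minus, plus, opp; simpl.
    pose proof (Rmin_r b (c + d / 2)). pose proof (cond_pos d).
    apply Rabs_def1; lra. }
  (* otherwise the supremum [c] could be passed *)
  assert (Hmin : Rmin b (c + d / 2) = b).
  { pose proof (cond_pos d). unfold Rmin in *. destruct (Rle_dec b (c + d / 2)); [reflexivity|].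
    assert (c + d / 2 <= c); [|lra]. apply Hub. split; [lra|exact HF]. }
  rewrite Hmin in HF. exact HF.
Qed.

Lemma ex_RInt_cont (g : R -> R) (a b : R) :
  (forall x, continuous g x) -> ex_RInt g a b.
Proof.
  intros Hg. apply (ex_RInt_continuous (V := R_CompleteNormedModule)).
  intros x _. apply Hg.
Qed.

Lemma continuous_RInt_param {U : UniformSpace} (g : U -> R -> R) (u0 : U) (a b : R) :
  a <= b ->
  (forall u x, continuous (g u) x) ->
  (forall x, continuous (fun p : U * R => g (fst p) (snd p)) (u0, x)) ->
  continuous (fun u => RInt (g u) a b) u0.
Proof.
  intros Hab Hg Hj.
  apply (filterlim_locally (F := locally u0)). intros eps.
  assert (Hd : 0 < eps / (2 * (b - a + 1))).
  { apply Rdiv_lt_0_compat; [apply cond_pos|lra]. }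
  set (d := mkposreal _ Hd).
  assert (HF : locally u0 (fun u => forall x, a <= x <= b ->
                 Rabs (g u x - g u0 x) <= 2 * d)).
  { apply (filter_forall_segment (locally u0)); [exact Hab|]. intros x _.
    assert (H1 := proj1 (filterlim_locally _ _) (Hj x) d). simpl in H1.
    assert (H2 := proj1 (filterlim_locally _ _) (Hg u0 x) d). simpl in H2.
    destruct H1 as [d1 H1]. destruct H2 as [d2 H2].
    apply (Filter_prod _ _ _ (ball u0 d1) (fun y => ball x d1 y /\ ball x d2 y)).
    - apply locally_ball.
    - apply filter_and; apply locally_ball.
    - intros u y Hu [Hy1 Hy2]. simpl.
      specialize (H1 (u, y) (conj Hu Hy1)). specialize (H2 y Hy2).
      simpl in H1. unfold ball in H1, H2; simpl in H1, H2.
      unfold AbsRing_ball, abs, minus, plus, opp in H1, H2; simpl in H1, H2.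
      apply Rabs_def2 in H1. apply Rabs_def2 in H2. apply Rabs_le. simpl. lra. }
  apply (filter_imp (fun u => forall x, a <= x <= b -> Rabs (g u x - g u0 x) <= 2 * d));
    [|exact HF].
  intros u Hu. unfold ball; simpl. unfold AbsRing_ball, abs, minus, plus, opp; simpl.
  change (Rabs (RInt (g u) a b - RInt (g u0) a b) < eps).
  rewrite <- (RInt_minus (V := R_CompleteNormedModule)) by (apply ex_RInt_cont, Hg).
  apply Rle_lt_trans with ((b - a) * (2 * d)).
  - apply abs_RInt_le_const; [exact Hab| |exact Hu].
    apply ex_RInt_cont. intros x. apply (continuous_minus (V := R_NormedModule)); apply Hg.
  - unfold d; simpl.
    replace ((b - a) * (2 * (eps / (2 * (b - a + 1))))) with (eps * ((b - a) / (b - a + 1)))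
      by (field; lra).
    rewrite <- (Rmult_1_r eps) at 2. apply Rmult_lt_compat_l; [apply cond_pos|].
    apply Rlt_div_l; lra.
Qed.

Lemma is_derive_RInt_integrand (g dg : R -> R -> R) (a b x : R) :
  (forall u v, is_derive (fun z => g z v) u (dg u v)) ->
  (forall u v, continuous (g u) v) ->
  (forall v, continuous (fun p : R * R => dg (fst p) (snd p)) (x, v)) ->
  is_derive (fun u => RInt (g u) a b) x (RInt (dg x) a b).
Proof.
  intros Hd Hg Hc.
  rewrite (RInt_ext (dg x) (fun v => Derive (fun z => g z v) x)).
  2:{ intros v _. symmetry. apply is_derive_unique, Hd. }
  apply (is_derive_RInt_param g).
  - apply filter_forall. intros u v _. exists (dg u v). apply Hd.
  - intros v _. apply continuity_2d_pt_ext with dg.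
    + intros u w. symmetry. apply is_derive_unique, Hd.
    + apply continuity_2d_pt_filterlim. apply Hc.
  - apply filter_forall. intros u. apply ex_RInt_cont, Hg.
Qed.

Lemma cont_add {U : UniformSpace} (u : U) (f g : U -> R) :
  continuous f u -> continuous g u -> continuous (fun x => f x + g x) u.
Proof. apply (continuous_plus (V := R_NormedModule)). Qed.

Lemma cont_mul {U : UniformSpace} (u : U) (f g : U -> R) :
  continuous f u -> continuous g u -> continuous (fun x => f x * g x) u.
Proof. apply (continuous_mult (K := R_AbsRing)). Qed.

(** For a smooth outer function, stated with a derivative because [auto_derive]
    finds one where continuity would need a further decomposition. *)
Lemma cont_comp {U : UniformSpace} (u : U) (f : U -> R) (h : R -> R) (dh : R -> R) :
  (forall y, is_derive h y (dh y)) -> continuous f u -> continuous (fun x => h (f x)) u.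
Proof.
  intros Hh Hf. apply continuous_comp; [exact Hf|].
  apply (ex_derive_continuous (K := R_AbsRing) (V := R_NormedModule)).
  eexists. apply Hh.
Qed.

Lemma cont_pow {U : UniformSpace} (u : U) (f : U -> R) (n : nat) :
  continuous f u -> continuous (fun x => f x ^ n) u.
Proof.
  apply (cont_comp u f (fun y => y ^ n) (fun y => INR n * y ^ pred n)).
  intros y. auto_derive; [exact I|ring].
Qed.

(** * The arc integrals *)

(** [c] stands for [cos phi].  This is [exp (- (r - t c)^2 / 2)] times the scaled
    Bessel function of [r t c], without the factor [(r t c / 2)^j]: the
    exponentials combine, and the result is even in [t], [r] and [c]. *)
Definition kernel (j : nat) (t r c : R) : R :=
  exp (- ((r ^ 2 + (t * c) ^ 2) / 2)) * bess j ((r * (t * c)) ^ 2 / 4).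

Definition arc_int (j n : nat) (t r : R) : R :=
  RInt (fun phi => kernel j t r (cos phi) * cos phi ^ n) 0 (PI / 2).

Lemma is_derive_kernel_t (j : nat) (t r c : R) :
  is_derive (fun s => kernel j s r c) t
    (- t * c ^ 2 * kernel j t r c + r ^ 2 * t / 2 * c ^ 2 * kernel (S j) t r c).
Proof.
  unfold kernel. auto_derive.
  - eexists; apply is_derive_bess.
  - rewrite (is_derive_unique _ _ _ (is_derive_bess j _)).
    replace (r * (t * c) * (r * (t * c) * 1) * / 4) with ((r * (t * c)) ^ 2 / 4) by field.
    replace (r * (r * 1) + t * c * (t * c * 1)) with (r ^ 2 + (t * c) ^ 2) by ring.
    unfold Rdiv. field.
Qed.

Lemma is_derive_kernel_r (j : nat) (t r c : R) :
  is_derive (fun s => kernel j t s c) r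
    (- r * kernel j t r c + r * t ^ 2 / 2 * c ^ 2 * kernel (S j) t r c).
Proof.
  unfold kernel. auto_derive.
  - eexists; apply is_derive_bess.
  - rewrite (is_derive_unique _ _ _ (is_derive_bess j _)).
    replace (r * (t * c) * (r * (t * c) * 1) * / 4) with ((r * (t * c)) ^ 2 / 4) by field.
    replace (r * (r * 1) + t * c * (t * c * 1)) with (r ^ 2 + (t * c) ^ 2) by ring.
    unfold Rdiv. field.
Qed.

Lemma is_derive_kernel_c (j : nat) (t r c : R) :
  is_derive (fun s => kernel j t r s) c
    (- t ^ 2 * c * kernel j t r c + r ^ 2 * t ^ 2 / 2 * c * kernel (S j) t r c).
Proof.
  unfold kernel. auto_derive.
  - eexists; apply is_derive_bess.
  - rewrite (is_derive_unique _ _ _ (is_derive_bess j _)).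
    replace (r * (t * c) * (r * (t * c) * 1) * / 4) with ((r * (t * c)) ^ 2 / 4) by field.
    replace (r * (r * 1) + t * c * (t * c * 1)) with (r ^ 2 + (t * c) ^ 2) by ring.
    unfold Rdiv. field.
Qed.

Lemma kernel_recurrence (t r c : R) :
  kernel 0 t r c - kernel 1 t r c = r ^ 2 * t ^ 2 / 4 * c ^ 2 * kernel 2 t r c.
Proof.
  unfold kernel. rewrite <- Rmult_minus_distr_l, <- bess_recurrence. field.
Qed.

Lemma cont_kernel {U : UniformSpace} (u : U) (j : nat) (t r c : U -> R) :
  continuous t u -> continuous r u -> continuous c u ->
  continuous (fun x => kernel j (t x) (r x) (c x)) u.
Proof.
  intros Ht Hr Hc. unfold kernel.
  assert (Htc : continuous (fun x => t x * c x) u) by (apply cont_mul; assumption).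
  apply cont_mul.
  - apply (cont_comp u (fun x => r x ^ 2 + (t x * c x) ^ 2) (fun y => exp (- (y / 2)))
             (fun y => - / 2 * exp (- (y / 2)))).
    + intros y. auto_derive; [exact I|]. unfold Rdiv. field.
    + apply cont_add; apply cont_pow; assumption.
  - apply (cont_comp u (fun x => r x * (t x * c x)) (fun y => bess j (y ^ 2 / 4))
             (fun y => y / 2 * bess (S j) (y ^ 2 / 4))).
    + intros y. auto_derive.
      * eexists; apply is_derive_bess.
      * rewrite (is_derive_unique _ _ _ (is_derive_bess j _)).
        replace (y * (y * 1) * / 4) with (y ^ 2 / 4) by field. field.
    + apply cont_mul; assumption.
Qed.

Lemma cont_arc_integrand {U : UniformSpace} (u : U) (j n : nat) (t r phi : U -> R) :
  continuous t u -> continuous r u -> continuous phi u ->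
  continuous (fun x => kernel j (t x) (r x) (cos (phi x)) * cos (phi x) ^ n) u.
Proof.
  intros Ht Hr Hphi.
  assert (Hc : continuous (fun x => cos (phi x)) u).
  { apply (cont_comp u phi cos (fun y => - sin y)); [|exact Hphi]. apply is_derive_cos. }
  apply cont_mul; [apply cont_kernel|apply cont_pow]; assumption.
Qed.

Lemma cont_arc_integrand_phi (j n : nat) (t r : R) (phi : R) :
  continuous (fun x => kernel j t r (cos x) * cos x ^ n) phi.
Proof.
  apply (cont_arc_integrand phi j n (fun _ => t) (fun _ => r) (fun x => x));
    [apply continuous_const|apply continuous_const|apply continuous_id].
Qed.

Lemma continuous_arc_int (j n : nat) (t r : R) :
  continuous (fun p : R * R => arc_int j n (fst p) (snd p)) (t, r).
Proof.
  pose proof PI_RGT_0.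
  apply (continuous_RInt_param
    (fun (p : R * R) phi => kernel j (fst p) (snd p) (cos phi) * cos phi ^ n)).
  - lra.
  - intros p phi. apply cont_arc_integrand_phi.
  - intros phi.
    apply (cont_arc_integrand _ j n (fun x : (R * R) * R => fst (fst x))
             (fun x => snd (fst x)) snd).
    + apply (continuous_comp fst fst); apply continuous_fst.
    + apply (continuous_comp fst snd); [apply continuous_fst|apply continuous_snd].
    + apply continuous_snd.
Qed.

Lemma ex_RInt_arc (j n : nat) (t r : R) :
  ex_RInt (fun phi => kernel j t r (cos phi) * cos phi ^ n) 0 (PI / 2).
Proof. apply ex_RInt_cont, cont_arc_integrand_phi. Qed.

Lemma is_RInt_arc (j n : nat) (t r : R) :
  is_RInt (fun phi => kernel j t r (cos phi) * cos phi ^ n) 0 (PI / 2) (arc_int j n t r).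
Proof. apply (RInt_correct (V := R_CompleteNormedModule)), ex_RInt_arc. Qed.

Lemma RInt_arc_lin2 (a b : R) (j n k m : nat) (t r : R) :
  RInt (fun phi => a * (kernel j t r (cos phi) * cos phi ^ n)
                   + b * (kernel k t r (cos phi) * cos phi ^ m)) 0 (PI / 2)
  = a * arc_int j n t r + b * arc_int k m t r.
Proof.
  apply is_RInt_unique.
  apply (is_RInt_plus (V := R_NormedModule));
    apply (is_RInt_scal (V := R_NormedModule)); apply is_RInt_arc.
Qed.

Lemma is_derive_arc_int_t (j n : nat) (t r : R) :
  is_derive (fun s => arc_int j n s r) t
    (- t * arc_int j (n + 2) t r + r ^ 2 * t / 2 * arc_int (S j) (n + 2) t r).
Proof.
  rewrite <- RInt_arc_lin2.
  apply (is_derive_RInt_integrand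
    (fun s phi => kernel j s r (cos phi) * cos phi ^ n)
    (fun s phi => - s * (kernel j s r (cos phi) * cos phi ^ (n + 2))
       + r ^ 2 * s / 2 * (kernel (S j) s r (cos phi) * cos phi ^ (n + 2)))).
  - intros s phi.
    evar_last.
    + apply (is_derive_ext (fun z => cos phi ^ n * kernel j z r (cos phi)));
        [intros z; apply Rmult_comm|].
      apply is_derive_scal, is_derive_kernel_t.
    + rewrite pow_add. unfold Rdiv. ring.
  - intros s phi. apply cont_arc_integrand_phi.
  - intros phi.
    assert (Hk : forall i, continuous (fun p : R * R =>
        kernel i (fst p) r (cos (snd p)) * cos (snd p) ^ (n + 2)) (t, phi)).
    { intros i. apply (cont_arc_integrand _ i (n + 2) fst (fun _ => r) snd);
        [apply continuous_fst|apply continuous_const|apply continuous_snd]. }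
    apply cont_add; apply cont_mul; try apply Hk.
    + apply (continuous_opp (V := R_NormedModule)), continuous_fst.
    + apply cont_mul; [|apply continuous_const].
      apply cont_mul; [apply continuous_const|apply continuous_fst].
Qed.

Lemma is_derive_arc_int_r (j n : nat) (t r : R) :
  is_derive (fun s => arc_int j n t s) r
    (- r * arc_int j n t r + r * t ^ 2 / 2 * arc_int (S j) (n + 2) t r).
Proof.
  rewrite <- RInt_arc_lin2.
  apply (is_derive_RInt_integrand
    (fun s phi => kernel j t s (cos phi) * cos phi ^ n)
    (fun s phi => - s * (kernel j t s (cos phi) * cos phi ^ n)
       + s * t ^ 2 / 2 * (kernel (S j) t s (cos phi) * cos phi ^ (n + 2)))).
  - intros s phi.
    evar_last.
    + apply (is_derive_ext (fun z => cos phi ^ n * kernel j t z (cos phi)));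
        [intros z; apply Rmult_comm|].
      apply is_derive_scal, is_derive_kernel_r.
    + rewrite pow_add. unfold Rdiv. ring.
  - intros s phi. apply cont_arc_integrand_phi.
  - intros phi.
    assert (Hk : forall i m, continuous (fun p : R * R =>
        kernel i t (fst p) (cos (snd p)) * cos (snd p) ^ m) (r, phi)).
    { intros i m. apply (cont_arc_integrand _ i m (fun _ => t) fst snd);
        [apply continuous_const|apply continuous_fst|apply continuous_snd]. }
    apply cont_add; apply cont_mul; try apply Hk.
    + apply (continuous_opp (V := R_NormedModule)), continuous_fst.
    + apply cont_mul; [|apply continuous_const].
      apply cont_mul; [apply continuous_fst|apply continuous_const].
Qed.

(** The integrated form of the three-term recurrence of the Bessel functions. *)
Lemma arc_int_recurrence (n : nat) (t r : R) :
  arc_int 0 n t r - arc_int 1 n t r = r ^ 2 * t ^ 2 / 4 * arc_int 2 (n + 2) t r.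
Proof.
  replace (arc_int 0 n t r - arc_int 1 n t r)
    with (1 * arc_int 0 n t r + (-1) * arc_int 1 n t r) by ring.
  replace (r ^ 2 * t ^ 2 / 4 * arc_int 2 (n + 2) t r)
    with (r ^ 2 * t ^ 2 / 4 * arc_int 2 (n + 2) t r + 0 * arc_int 2 (n + 2) t r) by ring.
  rewrite <- !RInt_arc_lin2. apply RInt_ext. intros phi _.
  pose proof (kernel_recurrence t r (cos phi)) as H.
  rewrite pow_add. match goal with |- ?a = ?b => change (@eq R a b) end.
  transitivity ((kernel 0 t r (cos phi) - kernel 1 t r (cos phi)) * cos phi ^ n); [ring|].
  rewrite H. unfold Rdiv. ring.
Qed.

(** The primitive [sin phi * cos phi ^ (n + 1) * kernel] vanishes at both ends of
    the quarter circle, so the integral of its derivative is zero; [sin^2] is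
    then replaced by [1 - cos^2]. *)
Lemma arc_int_by_parts (j n : nat) (t r : R) :
  (arc_int j (n + 2) t r - INR (S n) * (arc_int j n t r - arc_int j (n + 2) t r))
  + (t ^ 2 * (arc_int j (n + 2) t r - arc_int j (n + 4) t r)
     - r ^ 2 * t ^ 2 / 2 * (arc_int (S j) (n + 2) t r - arc_int (S j) (n + 4) t r)) = 0.
Proof.
  set (F := fun phi => sin phi * cos phi ^ S n * kernel j t r (cos phi)).
  set (k := fun i m phi => kernel i t r (cos phi) * cos phi ^ m).
  set (dF := fun phi =>
    (k j (n + 2)%nat phi - INR (S n) * (k j n phi - k j (n + 2)%nat phi))
    + (t ^ 2 * (k j (n + 2)%nat phi - k j (n + 4)%nat phi)
       - r ^ 2 * t ^ 2 / 2 * (k (S j) (n + 2)%nat phi - k (S j) (n + 4)%nat phi))).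
  assert (H1 : is_RInt dF 0 (PI / 2) (F (PI / 2) - F 0)).
  { apply (is_RInt_derive (V := R_CompleteNormedModule) F dF).
    - intros phi _. unfold F. auto_derive.
      + eexists; apply is_derive_kernel_c.
      + rewrite (is_derive_unique _ _ _ (is_derive_kernel_c j t r _)).
        unfold dF, k. rewrite !pow_add. change (pred (S n)) with n.
        assert (Hs : sin phi ^ 2 = 1 - cos phi ^ 2).
        { pose proof (sin2_cos2 phi) as E. unfold Rsqr in E. lra. }
        set (C := cos phi) in *. set (s := sin phi) in *.
        set (k0 := kernel j t r C). set (k1 := kernel (S j) t r C).
        change (match n with 0%nat => 1 | S _ => INR n + 1 end) with (INR (S n)).
        change (C ^ S n) with (C * C ^ n).
        transitivity (C * C ^ n * k0 * C - s ^ 2 * (INR (S n) * C ^ n * k0)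
          + s ^ 2 * C ^ 2 * C ^ n * (t ^ 2 * k0 - r ^ 2 * t ^ 2 / 2 * k1)).
        { unfold Rdiv. ring. }
        rewrite Hs. unfold Rdiv. ring.
    - intros phi _.
      assert (Hk : forall i m, continuous (k i m) phi) by (intros; apply cont_arc_integrand_phi).
      unfold dF.
      repeat match goal with
      | |- continuous (fun _ => _ - _) _ => apply (continuous_minus (V := R_NormedModule))
      | |- continuous (fun _ => _ + _) _ => apply cont_add
      | |- continuous (fun _ => _ * _) _ => apply cont_mul
      | |- continuous (fun _ => k _ _ _) _ => apply Hk
      | |- continuous (k _ _) _ => apply Hk
      | |- continuous (fun _ => _) _ => apply continuous_const
      end. }
  assert (H2 : is_RInt dF 0 (PI / 2)
    ((arc_int j (n + 2) t r - INR (S n) * (arc_int j n t r - arc_int j (n + 2) t r))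
     + (t ^ 2 * (arc_int j (n + 2) t r - arc_int j (n + 4) t r)
     - r ^ 2 * t ^ 2 / 2 * (arc_int (S j) (n + 2) t r - arc_int (S j) (n + 4) t r)))).
  { unfold dF.
    assert (Hk : forall i m, is_RInt (k i m) 0 (PI / 2) (arc_int i m t r))
      by (intros; apply is_RInt_arc).
    repeat match goal with
    | |- is_RInt (fun _ => _ - _) _ _ _ => apply (is_RInt_minus (V := R_NormedModule))
    | |- is_RInt (fun _ => _ + _) _ _ _ => apply (is_RInt_plus (V := R_NormedModule))
    | |- is_RInt (fun _ => _ * _) _ _ _ => apply (is_RInt_scal (V := R_NormedModule))
    | |- is_RInt _ _ _ _ => apply Hk
    end. }
  rewrite <- (is_RInt_unique _ _ _ _ H2), (is_RInt_unique _ _ _ _ H1).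
  unfold F. rewrite cos_PI2, sin_0. simpl. ring.
Qed.

(** * The substitution [1 - xi = cos phi] *)

Lemma is_derive_acos (x : R) : -1 < x < 1 -> is_derive acos x (-1 / sqrt (1 - x ^ 2)).
Proof.
  intros Hx. apply is_derive_Reals. replace (x ^ 2) with (Rsqr x) by (unfold Rsqr; ring).
  rewrite <- (derive_pt_acos x Hx). apply derive_pt_eq_1 with (derivable_pt_acos x Hx).
  reflexivity.
Qed.

(** [acos] is not differentiable at [1], so its continuity there is obtained from
    the monotonicity of [cos]. *)
Lemma filterlim_acos_at_1 :
  filterlim (fun x => acos (1 - x)) (at_right 0) (locally 0).
Proof.
  pose proof PI_RGT_0 as Hpi.
  apply filterlim_locally. intros eps.
  set (d := Rmin (eps / 2) (PI / 2)).
  assert (Hd : 0 < d <= PI / 2 /\ d < eps).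
  { pose proof (cond_pos eps). unfold d, Rmin. destruct (Rle_dec (eps / 2) (PI / 2)); lra. }
  assert (Hcos : 0 < 1 - cos d).
  { pose proof (cos_decreasing_1 0 d). rewrite cos_0 in *. lra. }
  exists (mkposreal _ Hcos). intros x Hx Hx0.
  unfold ball in *; simpl in *. unfold AbsRing_ball, abs, minus, plus, opp in *; simpl in *.
  apply Rabs_def2 in Hx.
  pose proof (acos_bound (1 - x)) as Hb. pose proof (COS_bound d) as Hcd.
  assert (acos (1 - x) < d).
  { apply Rnot_le_lt. intros Hle.
    destruct (Rle_lt_or_eq_dec _ _ Hle) as [Hlt|Heq].
    - pose proof (cos_decreasing_1 d (acos (1 - x))) as Hdec.
      rewrite cos_acos in Hdec by lra. lra.
    - assert (cos d = 1 - x) by (rewrite Heq; apply cos_acos; lra). lra. }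
  rewrite Rabs_pos_eq; lra.
Qed.

(** The substitution is made in the direction [phi = acos (1 - xi)], so that the
    function composed is the smooth integrand in [phi]; [acos (1 - xi)] is singular
    only at [xi = 0], the end at which the integral is improper, where the continuity
    of [acos] suffices. *)
Lemma J_arc_int (j n : nat) (t r : R) :
  J j n t r = (r * t / 2) ^ j * arc_int j (n + j) t r.
Proof.
  pose proof PI_RGT_0 as Hpi.
  unfold J. apply is_RInt_gen_unique.
  set (h := fun phi => (r * t / 2) ^ j *
                       (kernel j t r (cos phi) * cos phi ^ (n + j))).
  assert (Hh : forall x, continuous h x).
  { intros x. apply cont_mul; [apply continuous_const|apply cont_arc_integrand_phi]. }
  set (If := fun a => RInt h a (PI / 2)).
  assert (HIf : forall a, is_RInt h a (PI / 2) (If a)).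
  { intros a. apply (RInt_correct (V := R_CompleteNormedModule)), ex_RInt_cont, Hh. }
  replace ((r * t / 2) ^ j * arc_int j (n + j) t r) with (If 0).
  2:{ apply is_RInt_unique, (is_RInt_scal (V := R_NormedModule)), is_RInt_arc. }
  assert (Hlim : filterlim (fun x => If (acos (1 - x))) (at_right 0) (locally (If 0))).
  { eapply filterlim_comp; [apply filterlim_acos_at_1|].
    apply (continuous_RInt_2 (V := R_CompleteNormedModule) h 0 (PI / 2)).
    apply filter_forall. exact HIf. }
  intros P HP.
  apply (Filter_prod _ _ _ (fun a => 0 < a < 1 /\ P (If (acos (1 - a)))) (fun b => b = 1));
    [|reflexivity|].
  - apply filter_and; [|apply (Hlim P HP)].
    exists (mkposreal 1 Rlt_0_1). intros x Hx Hx0.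
    unfold ball in Hx; simpl in Hx. unfold AbsRing_ball, abs, minus, plus, opp in Hx; simpl in Hx.
    apply Rabs_def2 in Hx. lra.
  - intros a b [Ha HPa] ->. exists (If (acos (1 - a))). split; [|exact HPa]. simpl.
    unfold If. replace (PI / 2) with (acos (1 - 1)) by (rewrite Rminus_diag; apply acos_0).
    apply (is_RInt_ext (V := R_NormedModule)
      (fun x => scal (/ sqrt (1 - (1 - x) ^ 2)) (h (acos (1 - x))))).
    + intros x Hx. rewrite Rmin_left, Rmax_right in Hx by lra.
      unfold scal; simpl; unfold mult; simpl. unfold h, kernel, besselI_scaled.
      rewrite cos_acos by lra. rewrite besselI_bess.
      rewrite <- sqrt_mult by lra.
      replace (1 - (1 - x) * ((1 - x) * 1)) with (x * (2 - x)) by ring.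
      assert (Hs : sqrt (x * (2 - x)) <> 0).
      { apply Rgt_not_eq, sqrt_lt_R0, Rmult_lt_0_compat; lra. }
      replace (exp (- ((r ^ 2 + (t * (1 - x)) ^ 2) / 2)))
        with (exp (- ((r - t + t * x) ^ 2 / 2)) * exp (- (r * t * (1 - x)))).
      2:{ rewrite <- exp_plus. f_equal. field. }
      replace ((r * (t * (1 - x))) ^ 2) with ((r * t * (1 - x)) ^ 2) by ring.
      replace (r * t * (1 - x) / 2) with ((r * t / 2) * (1 - x)) by field.
      rewrite (Rpow_mult_distr (r * t / 2)), pow_add.
      change ((r - t + t * x) * ((r - t + t * x) * 1)) with ((r - t + t * x) ^ 2).
      field. exact Hs.
    + apply (is_RInt_comp (V := R_CompleteNormedModule) h (fun x => acos (1 - x))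
               (fun x => / sqrt (1 - (1 - x) ^ 2))).
      * intros x _. apply Hh.
      * intros x Hx. rewrite Rmin_left, Rmax_right in Hx by lra.
        assert (H1 : 0 < 1 - (1 - x) ^ 2) by nra.
        split.
        -- evar_last.
           ++ apply (is_derive_comp (K := R_AbsRing) (V := R_NormedModule) acos (fun x => 1 - x)).
              ** apply is_derive_acos. lra.
              ** auto_derive; [exact I|reflexivity].
           ++ change (-1 * (-1 / sqrt (1 - (1 - x) ^ 2)) = / sqrt (1 - (1 - x) ^ 2)).
              field. apply Rgt_not_eq, sqrt_lt_R0, H1.
        -- apply (ex_derive_continuous (K := R_AbsRing) (V := R_NormedModule)).
           auto_derive. simpl in H1.
           split; [lra|]. split; [|exact I]. apply Rgt_not_eq, sqrt_lt_R0. lra.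
Qed.

(** * The explicit pulsations *)

(** Derivative in [t] of [- t * arc_int 0 1 t r]. *)
Definition wave_t (t r : R) : R :=
  - arc_int 0 1 t r + t ^ 2 * arc_int 0 3 t r - r ^ 2 * t ^ 2 / 2 * arc_int 1 3 t r.

(** Derivative in [r] of [- t * arc_int 0 1 t r], divided by [r]; the quotient is
    regular at [r = 0]. *)
Definition wave_r_over_r (t r : R) : R := t * arc_int 0 1 t r - t ^ 3 / 2 * arc_int 1 3 t r.

Definition wave_tt (t r : R) : R :=
  3 * t * arc_int 0 3 t r - 3 / 2 * r ^ 2 * t * arc_int 1 3 t r - t ^ 3 * arc_int 0 5 t r
  + r ^ 2 * t ^ 3 * arc_int 1 5 t r - r ^ 4 * t ^ 3 / 4 * arc_int 2 5 t r.

Definition wave_rt_over_r (t r : R) : R :=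
  arc_int 0 1 t r - t ^ 2 * arc_int 0 3 t r + (r ^ 2 * t ^ 2 / 2 - 3 * t ^ 2 / 2) * arc_int 1 3 t r
  + t ^ 4 / 2 * arc_int 1 5 t r - r ^ 2 * t ^ 4 / 4 * arc_int 2 5 t r.

Ltac derive_arcs H :=
  auto_derive;
  [repeat split; eexists; apply H
  |rewrite !(fun j n t r => is_derive_unique _ _ _ (H j n t r)); simpl Nat.add;
   unfold Rdiv; try field].

Lemma is_derive_wave_t_t (t r : R) : is_derive (fun s => wave_t s r) t (wave_tt t r).
Proof. unfold wave_t, wave_tt. derive_arcs is_derive_arc_int_t. Qed.

Lemma is_derive_wave_t_r (t r : R) :
  is_derive (fun s => wave_t t s) r (r * wave_rt_over_r t r).
Proof. unfold wave_t, wave_rt_over_r. derive_arcs is_derive_arc_int_r. Qed.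

Lemma is_derive_wave_r_over_r_t (t r : R) :
  is_derive (fun s => wave_r_over_r s r) t (wave_rt_over_r t r).
Proof. unfold wave_r_over_r, wave_rt_over_r. derive_arcs is_derive_arc_int_t. Qed.

(** The equation [q_r = p_t - q / r].  It is the only one that does not reduce to
    a computation of derivatives: it carries the wave equation, and uses the
    integration by parts for [(j, n) = (0, 1)] and [(1, 1)] and the recurrence
    for [n = 1] and [n = 3]. *)
Lemma is_derive_wave_r_r (t r : R) :
  is_derive (fun s => s * wave_r_over_r t s) r (wave_tt t r - wave_r_over_r t r).
Proof.
  unfold wave_r_over_r, wave_tt. derive_arcs is_derive_arc_int_r.
  pose proof (arc_int_by_parts 0 1 t r) as B0.
  pose proof (arc_int_by_parts 1 1 t r) as B1.
  pose proof (arc_int_recurrence 1 t r) as C1.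
  pose proof (arc_int_recurrence 3 t r) as C3.
  simpl Nat.add in *. simpl (INR 2) in *.
  (* the coefficients of the linear combination that gives the identity *)
  apply (f_equal (fun x => t * x)) in B0.
  apply (f_equal (fun x => - (r ^ 2 * t / 2) * x)) in B1.
  apply (f_equal (fun x => r ^ 2 * t * x)) in C1.
  apply (f_equal (fun x => - (t ^ 3) * x)) in C3.
  unfold Rdiv in *. lra.
Qed.

(** * Conservation laws in a backward cone *)

Lemma ball_R (x y d : R) : ball x d y <-> Rabs (y - x) < d.
Proof. reflexivity. Qed.

Lemma continuity_2d_pt_snd (f : R -> R -> R) (t x : R) :
  continuity_2d_pt f t x -> continuous (f t) x.
Proof.
  intros H. apply continuity_2d_pt_filterlim in H.
  apply (continuous_comp_2 (fun _ : R => t) (fun y : R => y) f);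
    [apply continuous_const|apply continuous_id|exact H].
Qed.

Lemma locally_pos (t : R) : 0 < t -> locally t (fun s => 0 < s).
Proof. intros Ht. apply (open_gt 0 t Ht). Qed.

Lemma is_derive_cone_energy (e de : R -> R -> R) (T0 t : R) :
  (forall t x, 0 < t -> continuity_2d_pt e t x) ->
  (forall t x, 0 < t -> continuity_2d_pt de t x) ->
  (forall t x, 0 < t -> is_derive (fun s => e s x) t (de t x)) ->
  0 < t ->
  is_derive (fun s => RInt (e s) 0 (T0 - s)) t
    (RInt (de t) 0 (T0 - t) - e t (T0 - t)).
Proof.
  intros He Hdec Hde Ht.
  assert (Hce : forall s x, 0 < s -> continuous (e s) x).
  { intros s x Hs. apply continuity_2d_pt_snd, He, Hs. }
  assert (HD : forall s x, 0 < s -> Derive (fun z => e z x) s = de s x).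
  { intros s x Hs. apply is_derive_unique, Hde, Hs. }
  assert (Hc2 : forall s x, 0 < s ->
            continuity_2d_pt (fun u v => Derive (fun z => e z v) u) s x).
  { intros s x Hs. apply continuity_2d_pt_ext_loc with de; [|apply Hdec, Hs].
    exists (mkposreal s Hs). intros u v Hu _. simpl in Hu. apply Rabs_def2 in Hu.
    symmetry. apply HD. lra. }
  assert (Hint : forall a b, locally t (fun s => ex_RInt (e s) a b)).
  { intros a b. apply (filter_imp (fun s => 0 < s)); [|apply locally_pos, Ht].
    intros s Hs. apply ex_RInt_cont. intros x. apply Hce, Hs. }
  rewrite (RInt_ext (de t) (fun x => Derive (fun z => e z x) t)).
  2:{ intros x _. symmetry. apply HD, Ht. }
  evar_last.
  - apply (is_derive_RInt_param_bound_comp_aux3 e 0 (fun s => T0 - s) t (-1)).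
    + apply Hint.
    + exists (mkposreal 1 Rlt_0_1). apply Hint.
    + auto_derive; [exact I|ring].
    + exists (mkposreal 1 Rlt_0_1).
      apply (filter_imp (fun s => 0 < s)); [|apply locally_pos, Ht].
      intros s Hs x _. exists (de s x). apply Hde, Hs.
    + intros x _. apply Hc2, Ht.
    + exists (mkposreal t Ht). intros u v Hu _. simpl in Hu. apply Rabs_def2 in Hu.
      apply Hc2. lra.
    + apply continuity_pt_filterlim, Hce, Ht.
  - simpl. ring.
Qed.

(** Finite speed of propagation for a conservation law [e_t = f_x] whose flux is
    bounded by its density: nothing enters a backward cone through its side, so
    the content of its sections decreases from its initial value, which is
    zero. *)
Lemma conserved_density_zero (e f de : R -> R -> R) :
  (forall t x, 0 < t -> continuity_2d_pt e t x) ->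
  (forall t x, 0 < t -> continuity_2d_pt de t x) ->
  (forall t x, 0 < t -> is_derive (fun s => e s x) t (de t x)) ->
  (forall t x, 0 < t -> 0 <= x -> is_derive (f t) x (de t x)) ->
  (forall t, 0 < t -> f t 0 = 0) ->
  (forall t x, 0 < t -> 0 <= x -> Rabs (f t x) <= e t x) ->
  (forall x eps, 0 <= x -> 0 < eps ->
     filter_prod (at_right 0) (locally x) (fun p => e (fst p) (snd p) < eps)) ->
  forall t x, 0 < t -> 0 < x -> e t x = 0.
Proof.
  intros He Hdec Hde Hf Hf0 Hdom Hinit.
  assert (Hce : forall s x, 0 < s -> continuous (e s) x).
  { intros s x Hs. apply continuity_2d_pt_snd, He, Hs. }
  assert (Hpos : forall s x, 0 < s -> 0 <= x -> 0 <= e s x).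
  { intros s x Hs Hx. apply Rle_trans with (2 := Hdom s x Hs Hx). apply Rabs_pos. }
  assert (Hex : forall s a b, 0 < s -> ex_RInt (e s) a b).
  { intros s a b Hs. apply ex_RInt_cont. intros x. apply Hce, Hs. }
  (* the flux through the lateral boundary of the cone cannot exceed the density there *)
  assert (Hdecr : forall T0 s t, 0 < s -> s < t -> t < T0 ->
            RInt (e t) 0 (T0 - t) <= RInt (e s) 0 (T0 - s)).
  { intros T0 s t Hs Hst HtT.
    assert (HE : forall z, 0 < z -> is_derive (fun s => RInt (e s) 0 (T0 - s)) z
                  (RInt (de z) 0 (T0 - z) - e z (T0 - z))).
    { intros z Hz. apply is_derive_cone_energy; assumption. }
    destruct (MVT_gen (fun s => RInt (e s) 0 (T0 - s)) s t
                (fun z => RInt (de z) 0 (T0 - z) - e z (T0 - z))) as [c [Hc Heq]].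
    - intros z Hz. rewrite Rmin_left, Rmax_right in Hz by lra. apply HE. lra.
    - intros z Hz. rewrite Rmin_left, Rmax_right in Hz by lra.
      apply continuity_pt_filterlim.
      apply (ex_derive_continuous (K := R_AbsRing) (V := R_NormedModule)
               (fun s => RInt (e s) 0 (T0 - s))).
      eexists. apply HE. lra.
    - rewrite Rmin_left, Rmax_right in Hc by lra.
      assert (HRI : RInt (de c) 0 (T0 - c) = f c (T0 - c) - f c 0).
      { apply is_RInt_unique.
        apply (is_RInt_derive (V := R_CompleteNormedModule) (f c) (de c)).
        - intros x Hx. rewrite Rmin_left, Rmax_right in Hx by lra. apply Hf; lra.
        - intros x _. apply continuity_2d_pt_snd, Hdec. lra. }
      rewrite HRI, Hf0 in Heq by lra.
      assert (Hle : f c (T0 - c) <= e c (T0 - c)).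
      { apply Rle_trans with (1 := Rle_abs _). apply Hdom; lra. }
      assert ((f c (T0 - c) - 0 - e c (T0 - c)) * (t - s) <= 0) by nra.
      lra. }
  assert (Hzero : forall t x, 0 < t -> 0 < x -> RInt (e t) 0 x = 0).
  { intros t x Ht Hx. apply Rle_antisym.
    2:{ apply RInt_ge_0; [lra|apply Hex, Ht|]. intros y Hy. apply Hpos; lra. }
    apply Rnot_lt_le. intros Hlt.
    set (T0 := t + x).
    (* a density below [eps] on [0, T0] leaves at most half of the alleged energy *)
    set (eps := RInt (e t) 0 x / (2 * T0)).
    assert (Heps : 0 < eps) by (apply Rdiv_lt_0_compat; unfold T0; lra).
    assert (HF : at_right 0 (fun s => forall y, 0 <= y <= T0 -> e s y < eps)).
    { apply (filter_forall_segment (at_right 0)); [unfold T0; lra|].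
      intros y Hy. apply Hinit; lra. }
    destruct HF as [d Hd].
    set (s := Rmin (d / 2) (t / 2)).
    assert (Hs : 0 < s /\ s < d /\ s < t).
    { pose proof (cond_pos d). unfold s, Rmin. destruct (Rle_dec (d / 2) (t / 2)); lra. }
    assert (Hsm : forall y, 0 <= y <= T0 -> e s y < eps).
    { apply Hd; [|lra]. apply ball_R. apply Rabs_def1; lra. }
    assert (H1 := Hdecr T0 s t). replace (T0 - t) with x in H1 by (unfold T0; ring).
    assert (H2 : RInt (e s) 0 (T0 - s) <= (T0 - s) * eps).
    { apply Rle_trans with (RInt (fun _ => eps) 0 (T0 - s)).
      - apply RInt_le; [unfold T0; lra|apply Hex; lra|apply ex_RInt_const|].
        intros y Hy. left. apply Hsm. lra.
      - rewrite RInt_const. unfold scal; simpl; unfold mult; simpl. lra. }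
    assert (H3 : T0 * eps = RInt (e t) 0 x / 2) by (unfold eps; field; unfold T0; lra).
    assert (RInt (e t) 0 x <= RInt (e s) 0 (T0 - s)) by (apply H1; unfold T0; lra).
    nra. }
  intros t x Ht Hx.
  assert (HD : is_derive (fun y => RInt (e t) 0 y) x (e t x)).
  { apply (is_derive_RInt (V := R_NormedModule) _ _ 0); [|apply Hce, Ht].
    apply filter_forall. intros y. apply (RInt_correct (V := R_CompleteNormedModule)), Hex, Ht. }
  assert (HD0 : is_derive (fun y => RInt (e t) 0 y) x 0).
  { apply (is_derive_ext_loc (fun _ => 0)).
    - apply (filter_imp (fun y => 0 < y)); [|apply locally_pos, Hx].
      intros y Hy. symmetry. apply Hzero; assumption.
    - apply (is_derive_const (K := R_AbsRing) (V := R_NormedModule)). }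
  rewrite <- (is_derive_unique _ _ _ HD). apply is_derive_unique, HD0.
Qed.

(** * The radial acoustic system *)

Lemma filterlim_R_iff {U : Type} (F : (U -> Prop) -> Prop) {FF : Filter F} (f : U -> R) (l : R) :
  filterlim f F (locally l) <->
  forall eps : posreal, F (fun u => Rabs (f u - l) < eps).
Proof. apply (filterlim_locally (F := F) f l). Qed.

Lemma filterlim_Rminus {U : Type} (F : (U -> Prop) -> Prop) {FF : Filter F}
    (f g : U -> R) (a b : R) :
  filterlim f F (locally a) -> filterlim g F (locally b) ->
  filterlim (fun u => f u - g u) F (locally (a - b)).
Proof.
  intros Hf Hg. apply (filterlim_R_iff F). intros eps.
  assert (Hf' := proj1 (filterlim_R_iff F f a) Hf (pos_div_2 eps)).
  assert (Hg' := proj1 (filterlim_R_iff F g b) Hg (pos_div_2 eps)).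
  eapply filter_imp; [|apply (filter_and _ _ Hf' Hg')].
  intros u [Hfu Hgu]. simpl in Hfu, Hgu.
  apply Rabs_def2 in Hfu. apply Rabs_def2 in Hgu. apply Rabs_def1; lra.
Qed.

(** The equations [p_t = q_x + q / x], [q_t = p_x] of [p = W_t], [q = W_r] for a
    radial wave [W] in the plane.  The first one is written as
    [(x q)_x = x p_t], which makes sense at [x = 0]. *)
Record acoustic (p q pt qt : R -> R -> R) : Prop := {
  acoustic_cont_p : continuous_on (fun z : R * R => 0 <= fst z) (fun z => p (fst z) (snd z));
  acoustic_cont_q : continuous_on (fun z : R * R => 0 <= fst z) (fun z => q (fst z) (snd z));
  acoustic_cont_pt : forall t x, 0 < t -> continuity_2d_pt pt t x;
  acoustic_cont_qt : forall t x, 0 < t -> continuity_2d_pt qt t x;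
  acoustic_pt : forall t x, 0 < t -> is_derive (fun s => p s x) t (pt t x);
  acoustic_qt : forall t x, 0 < t -> is_derive (fun s => q s x) t (qt t x);
  acoustic_px : forall t x, 0 < t -> is_derive (p t) x (qt t x);
  acoustic_qx : forall t x, 0 < t -> 0 <= x ->
    is_derive (fun y => y * q t y) x (x * pt t x)
}.

Lemma continuous_on_halfplane_2d (g : R -> R -> R) (t x : R) :
  continuous_on (fun z : R * R => 0 <= fst z) (fun z => g (fst z) (snd z)) ->
  0 < t -> continuity_2d_pt g t x.
Proof.
  intros Hg Ht. apply continuity_2d_pt_filterlim. apply (filterlim_R_iff (locally (t, x))).
  intros eps.
  assert (H := proj1 (filterlim_R_iff _ _ _) (Hg (t, x) (Rlt_le _ _ Ht)) eps).
  destruct H as [d Hd].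
  exists (mkposreal _ (Rmin_pos d t (cond_pos d) Ht)). intros [s y] [Hs Hy].
  change (Rabs (s - t) < Rmin d t) in Hs. change (Rabs (y - x) < Rmin d t) in Hy.
  pose proof (Rmin_l d t). pose proof (Rmin_r d t).
  apply (Hd (s, y)).
  - split; apply ball_R; simpl; lra.
  - apply Rabs_def2 in Hs. simpl. lra.
Qed.

Lemma acoustic_minus (p q pt qt p' q' pt' qt' : R -> R -> R) :
  acoustic p q pt qt -> acoustic p' q' pt' qt' ->
  acoustic (fun t x => p t x - p' t x) (fun t x => q t x - q' t x)
           (fun t x => pt t x - pt' t x) (fun t x => qt t x - qt' t x).
Proof.
  intros [Cp Cq Cpt Cqt Dp Dq Xp Xq] [Cp' Cq' Cpt' Cqt' Dp' Dq' Xp' Xq'].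
  split.
  - intros z Hz. apply filterlim_Rminus;
      [apply within_filter, locally_filter|apply Cp, Hz|apply Cp', Hz].
  - intros z Hz. apply filterlim_Rminus;
      [apply within_filter, locally_filter|apply Cq, Hz|apply Cq', Hz].
  - intros t x Ht. apply continuity_2d_pt_minus; auto.
  - intros t x Ht. apply continuity_2d_pt_minus; auto.
  - intros t x Ht. apply (is_derive_minus (V := R_NormedModule)); auto.
  - intros t x Ht. apply (is_derive_minus (V := R_NormedModule)); auto.
  - intros t x Ht. apply (is_derive_minus (V := R_NormedModule)); auto.
  - intros t x Ht Hx. rewrite Rmult_minus_distr_l.
    apply (is_derive_ext (fun y => y * q t y - y * q' t y));
      [intros y; symmetry; apply Rmult_minus_distr_l|].
    apply (is_derive_minus (V := R_NormedModule)); auto.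
Qed.

Lemma eq_0_of_right_limit (g : R -> R) :
  continuous g 0 -> (forall x, 0 < x -> g x = 0) -> g 0 = 0.
Proof.
  intros Hg H. apply NNPP. intros Hn.
  assert (Hp : 0 < Rabs (g 0)) by (apply Rabs_pos_lt, Hn).
  destruct (proj1 (filterlim_R_iff (locally 0) g (g 0)) Hg (mkposreal _ Hp)) as [d Hd].
  assert (H2 : Rabs (g (d / 2) - g 0) < Rabs (g 0)).
  { apply Hd, ball_R. pose proof (cond_pos d). apply Rabs_def1; lra. }
  rewrite H in H2 by (pose proof (cond_pos d); lra).
  unfold Rminus in H2. rewrite Rplus_0_l, Rabs_Ropp in H2. lra.
Qed.

(** The conserved density is [x (p^2 + q^2)], with flux [2 x p q]; the weight [x]
    is the area element of the plane in polar coordinates. *)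
Lemma acoustic_zero (p q pt qt : R -> R -> R) :
  acoustic p q pt qt ->
  (forall x, 0 <= x -> p 0 x = 0 /\ q 0 x = 0) ->
  forall t x, 0 <= t -> 0 <= x -> p t x = 0 /\ q t x = 0.
Proof.
  intros [Cp Cq Cpt Cqt Dp Dq Xp Xq] H0.
  assert (Cp2 : forall t x, 0 < t -> continuity_2d_pt p t x).
  { intros. apply continuous_on_halfplane_2d; assumption. }
  assert (Cq2 : forall t x, 0 < t -> continuity_2d_pt q t x).
  { intros. apply continuous_on_halfplane_2d; assumption. }
  assert (HE : forall t x, 0 < t -> 0 < x -> x * (p t x * p t x + q t x * q t x) = 0).
  { apply (conserved_density_zero (fun t x => x * (p t x * p t x + q t x * q t x))
             (fun t x => 2 * (p t x * (x * q t x)))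
             (fun t x => 2 * (x * (p t x * pt t x + q t x * qt t x)))).
    - intros t x Ht.
      repeat first [apply continuity_2d_pt_plus | apply continuity_2d_pt_mult
                   | apply continuity_2d_pt_id2]; auto.
    - intros t x Ht.
      repeat first [apply continuity_2d_pt_const | apply continuity_2d_pt_plus
        | apply continuity_2d_pt_mult | apply continuity_2d_pt_id2]; auto.
    - intros t x Ht. auto_derive.
      + pose proof (ex_intro _ _ (Dp t x Ht) : ex_derive _ _) as Ep.
        pose proof (ex_intro _ _ (Dq t x Ht) : ex_derive _ _) as Eq.
        exact (conj Ep (conj Ep (conj Eq (conj Eq I)))).
      + assert (E1 : Derive (fun s : R => p s x) t = pt t x) by (apply is_derive_unique, Dp, Ht).
        assert (E2 : Derive (fun s : R => q s x) t = qt t x) by (apply is_derive_unique, Dq, Ht).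
        rewrite E1, E2. ring.
    - intros t x Ht Hx.
      evar_last.
      + apply is_derive_scal.
        apply (is_derive_mult (p t) (fun y => y * q t y)); [apply Xp, Ht|apply Xq; assumption|].
        intros; apply Rmult_comm.
      + unfold plus, mult; simpl. ring.
    - intros t Ht. ring.
    - intros t x Ht Hx. apply Rabs_le.
      pose proof (Rle_0_sqr (p t x + q t x)) as H1.
      pose proof (Rle_0_sqr (p t x - q t x)) as H2. unfold Rsqr in *.
      apply (Rmult_le_compat_l x) in H1; [|exact Hx].
      apply (Rmult_le_compat_l x) in H2; [|exact Hx]. lra.
    - intros x eps Hx Heps.
      (* near [x] the weight is below [x + 1], and [d <= 1] gives [d * d <= d] *)
      assert (Hd : 0 < Rmin 1 (eps / (2 * (x + 1)))).
      { apply Rmin_pos; [lra|]. apply Rdiv_lt_0_compat; lra. }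
      set (d := mkposreal _ Hd).
      assert (Hsmall : forall g : R -> R -> R,
        continuous_on (fun z : R * R => 0 <= fst z) (fun z => g (fst z) (snd z)) ->
        g 0 x = 0 ->
        filter_prod (at_right 0) (locally x) (fun z => Rabs (g (fst z) (snd z)) < d)).
      { intros g Hg Hg0.
        assert (H := proj1 (filterlim_R_iff _ _ _) (Hg (0, x) (Rle_refl 0)) d).
        simpl in H. rewrite Hg0 in H. destruct H as [r Hr].
        apply (Filter_prod _ _ _ (fun s => 0 < s /\ ball 0 r s) (ball x r)).
        - exists r. intros s Hs Hs0. split; assumption.
        - apply locally_ball.
        - intros s y [Hs0 Hs] Hy. specialize (Hr (s, y) (conj Hs Hy) (Rlt_le _ _ Hs0)).
          rewrite Rminus_0_r in Hr. exact Hr. }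
      assert (Hx1 : filter_prod (at_right 0) (locally x)
                (fun z => 0 < fst z /\ Rabs (snd z - x) < 1)).
      { apply (Filter_prod _ _ _ (fun s => 0 < s) (ball x 1)).
        - exists (mkposreal 1 Rlt_0_1). intros s _ Hs. exact Hs.
        - apply (locally_ball x (mkposreal 1 Rlt_0_1)).
        - intros s y Hs Hy. split; [exact Hs|]. exact Hy. }
      eapply filter_imp;
        [|apply (filter_and _ _ Hx1 (filter_and _ _ (Hsmall p Cp (proj1 (H0 x Hx)))
                                                  (Hsmall q Cq (proj2 (H0 x Hx)))))].
      intros [s y] [[Hs Hy] [Hp Hq]]. cbn [fst snd] in *.
      assert (Hd1 : d <= 1) by apply Rmin_l.
      assert (Hd2 : d <= eps / (2 * (x + 1))) by apply Rmin_r.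
      assert (Hd3 : (x + 1) * (2 * d) <= eps).
      { apply (Rmult_le_compat_l (2 * (x + 1))) in Hd2; [|lra].
        replace (2 * (x + 1) * (eps / (2 * (x + 1)))) with eps in Hd2 by (field; lra). lra. }
      assert (Hpos : 0 < d) by apply cond_pos.
      apply Rabs_def2 in Hp. apply Rabs_def2 in Hq. apply Rabs_def2 in Hy.
      assert (Hp2 : p s y * p s y < d) by nra.
      assert (Hq2 : q s y * q s y < d) by nra.
      assert (Hsum : 0 <= p s y * p s y + q s y * q s y) by nra.
      apply Rle_lt_trans with ((x + 1) * (p s y * p s y + q s y * q s y)).
      + apply Rmult_le_compat_r; [exact Hsum|lra].
      + apply Rlt_le_trans with (2 := Hd3). apply Rmult_lt_compat_l; lra. }
  intros t x [Ht|<-] Hx; [|apply H0, Hx].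
  assert (Hpos : forall y, 0 < y -> p t y = 0 /\ q t y = 0).
  { intros y Hy. specialize (HE t y Ht Hy).
    apply Rmult_integral in HE. destruct HE as [HE|HE]; [lra|].
    split; nra. }
  destruct Hx as [Hx|<-]; [apply Hpos, Hx|].
  split; apply eq_0_of_right_limit.
  - apply continuity_2d_pt_snd, Cp2, Ht.
  - intros y Hy. apply Hpos, Hy.
  - apply continuity_2d_pt_snd, Cq2, Ht.
  - intros y Hy. apply Hpos, Hy.
Qed.

Lemma acoustic_unique (p q pt qt p' q' pt' qt' : R -> R -> R) :
  acoustic p q pt qt -> acoustic p' q' pt' qt' ->
  (forall x, 0 <= x -> p 0 x = p' 0 x /\ q 0 x = q' 0 x) ->
  forall t x, 0 <= t -> 0 <= x -> p t x = p' t x /\ q t x = q' t x.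
Proof.
  intros H H' H0 t x Ht Hx.
  destruct (acoustic_zero _ _ _ _ (acoustic_minus _ _ _ _ _ _ _ _ H H')) with (t := t) (x := x)
    as [E1 E2]; [|assumption|assumption|lra].
  intros y Hy. destruct (H0 y Hy). lra.
Qed.

Lemma continuity_2d_arc_int (j n : nat) (t r : R) : continuity_2d_pt (arc_int j n) t r.
Proof. apply continuity_2d_pt_filterlim. exact (continuous_arc_int j n t r). Qed.

Ltac cont_2d :=
  repeat match goal with
  | |- continuity_2d_pt (fun _ _ => arc_int ?j ?n _ _) _ _ => apply (continuity_2d_arc_int j n)
  | |- continuity_2d_pt (arc_int ?j ?n) _ _ => apply (continuity_2d_arc_int j n)
  | |- continuity_2d_pt (fun u v => u) _ _ => apply continuity_2d_pt_id1
  | |- continuity_2d_pt (fun u v => v) _ _ => apply continuity_2d_pt_id2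
  | |- continuity_2d_pt (fun _ _ => _ + _) _ _ => apply continuity_2d_pt_plus
  | |- continuity_2d_pt (fun _ _ => _ - _) _ _ => apply continuity_2d_pt_minus
  | |- continuity_2d_pt (fun _ _ => - _) _ _ => apply continuity_2d_pt_opp
  | |- continuity_2d_pt (fun _ _ => _ * _) _ _ => apply continuity_2d_pt_mult
  | |- continuity_2d_pt (fun _ _ => _) _ _ => apply continuity_2d_pt_const
  end.

Lemma continuity_2d_wave_t (t r : R) : continuity_2d_pt wave_t t r.
Proof. unfold wave_t, Rdiv, pow. cont_2d. Qed.

Lemma continuity_2d_wave_r_over_r (t r : R) : continuity_2d_pt wave_r_over_r t r.
Proof. unfold wave_r_over_r, Rdiv, pow. cont_2d. Qed.

Lemma continuity_2d_wave_tt (t r : R) : continuity_2d_pt wave_tt t r.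
Proof. unfold wave_tt, Rdiv, pow. cont_2d. Qed.

Lemma continuity_2d_wave_rt_over_r (t r : R) : continuity_2d_pt wave_rt_over_r t r.
Proof. unfold wave_rt_over_r, Rdiv, pow. cont_2d. Qed.

Lemma acoustic_wave :
  acoustic wave_t (fun t r => r * wave_r_over_r t r) wave_tt (fun t r => r * wave_rt_over_r t r).
Proof.
  assert (Hon : forall g : R -> R -> R, (forall t x, continuity_2d_pt g t x) ->
    continuous_on (fun z : R * R => 0 <= fst z) (fun z => g (fst z) (snd z))).
  { intros g Hg [t x] _. apply (filterlim_filter_le_1 (F := locally (t, x))).
    - intros P HP. apply filter_le_within; exact HP.
    - apply continuity_2d_pt_filterlim, Hg. }
  split.
  - apply (Hon wave_t). apply continuity_2d_wave_t.
  - apply (Hon (fun t r => r * wave_r_over_r t r)). intros t x.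
    apply continuity_2d_pt_mult; [apply continuity_2d_pt_id2|apply continuity_2d_wave_r_over_r].
  - intros t x _. apply continuity_2d_wave_tt.
  - intros t x _.
    apply continuity_2d_pt_mult; [apply continuity_2d_pt_id2|apply continuity_2d_wave_rt_over_r].
  - intros t x _. apply is_derive_wave_t_t.
  - intros t x _. apply is_derive_scal, is_derive_wave_r_over_r_t.
  - intros t x _. apply is_derive_wave_t_r.
  - intros t x _ _. evar_last.
    + apply (is_derive_mult (fun y => y) (fun y => y * wave_r_over_r t y));
        [apply (is_derive_id (K := R_AbsRing))|apply is_derive_wave_r_r|intros; apply Rmult_comm].
    + unfold plus, mult, one; simpl. unfold one; simpl. ring.
Qed.

Lemma arc_int_0_1_0 (r : R) : arc_int 0 1 0 r = exp (- (r ^ 2 / 2)).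
Proof.
  apply is_RInt_unique.
  apply (is_RInt_ext (V := R_NormedModule) (fun phi => exp (- (r ^ 2 / 2)) * cos phi)).
  - intros phi _. unfold kernel.
    replace ((r * (0 * cos phi)) ^ 2 / 4) with 0 by field.
    replace (r ^ 2 + (0 * cos phi) ^ 2) with (r ^ 2) by ring.
    unfold bess. rewrite PSeries_0. unfold bess_coef. simpl. field.
  - evar_last.
    + refine (is_RInt_scal (V := R_NormedModule) cos _ _ _ _ _).
      refine (is_RInt_derive (V := R_CompleteNormedModule) sin cos _ _ _ _).
      * intros x _. apply is_derive_sin.
      * intros x _. apply continuous_cos.
    + change (exp (- (r ^ 2 / 2)) * (sin (PI / 2) - sin 0) = exp (- (r ^ 2 / 2))).
      rewrite sin_PI2, sin_0. ring.
Qed.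

(** * From the wave equation to the radial system *)

Lemma is_derive_within_iff (D : R -> Prop) (f : R -> R) (x l : R) :
  D x ->
  is_derive_within D f x l <->
  forall eps : posreal, exists d : posreal, forall y, D y -> Rabs (y - x) < d ->
    Rabs (f y - f x - (y - x) * l) <= eps * Rabs (y - x).
Proof.
  intros Dx. split.
  - intros [_ H] eps.
    destruct (H x (fun P HP => filter_le_within D P HP) eps) as [d Hd].
    exists d. intros y Dy Hy. exact (Hd y Hy Dy).
  - intros H. split; [apply (is_linear_scal_l (K := R_AbsRing) (V := R_NormedModule))|].
    intros z Hz eps.
    assert (Hzx : z = x).
    { apply NNPP. intros Hn.
      assert (Hp : 0 < Rabs (x - z)) by (apply Rabs_pos_lt, Rminus_eq_contra; congruence).
      destruct (Hz (ball z (mkposreal _ Hp)) (locally_ball z (mkposreal _ Hp))) as [d Hd].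
      assert (Hxx : ball z (mkposreal _ Hp) x) by (apply Hd; [apply ball_center|exact Dx]).
      apply ball_R in Hxx. exact (Rlt_irrefl _ Hxx). }
    rewrite Hzx. destruct (H eps) as [d Hd]. exists d. intros y Hy Dy. exact (Hd y Dy Hy).
Qed.

Lemma is_derive_within_translate (D D' : R -> Prop) (f g : R -> R) (x l : R) :
  D x -> (forall y, D y -> D' (y - x) /\ g y = f (y - x)) ->
  is_derive_within D' f 0 l -> is_derive_within D g x l.
Proof.
  intros Dx Hfg Hf.
  destruct (Hfg x Dx) as [D0 E0]. rewrite Rminus_diag in D0, E0.
  apply is_derive_within_iff; [exact Dx|]. intros eps.
  apply is_derive_within_iff with (eps := eps) in Hf; [|exact D0].
  destruct Hf as [d Hd]. exists d. intros y Dy Hy.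
  destruct (Hfg y Dy) as [Dy' Ey]. specialize (Hd (y - x) Dy').
  rewrite Rminus_0_r in Hd. rewrite Ey, E0. apply Hd, Hy.
Qed.

(** Partial derivatives are taken at the increment [0] of a shifted point; this
    moves them to the point itself, at interior points. *)
Lemma is_derive_of_shifted (D : R -> Prop) (f g : R -> R) (x l : R) :
  (forall h, g (x + h) = f h) -> locally 0 D ->
  is_derive_within D f 0 l -> is_derive g x l.
Proof.
  intros Hfg HD Hf.
  assert (H : is_derive_within (fun y => D (y - x)) g x l).
  { apply (is_derive_within_translate _ D f).
    - rewrite Rminus_diag. apply locally_singleton, HD.
    - intros y Dy. split; [exact Dy|]. rewrite <- Hfg. f_equal. ring.
    - exact Hf. }
  destruct HD as [d HD].
  split; [apply (is_linear_scal_l (K := R_AbsRing) (V := R_NormedModule))|].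
  intros z Hz eps. apply (is_filter_lim_locally_unique (V := R_NormedModule) x z) in Hz.
  rewrite <- Hz. clear z Hz.
  apply is_derive_within_iff with (eps := eps) in H.
  2:{ rewrite Rminus_diag. apply HD, ball_center. }
  destruct H as [d' Hd']. exists (mkposreal _ (Rmin_pos d d' (cond_pos d) (cond_pos d'))).
  intros y Hy. apply ball_R in Hy. simpl in Hy.
  apply (Hd' y).
  - apply HD, ball_R. rewrite Rminus_0_r. apply Rlt_le_trans with (1 := Hy), Rmin_l.
  - apply Rlt_le_trans with (1 := Hy), Rmin_r.
Qed.

Lemma C1_on_is_derive (D : point -> Prop) (u : point -> R) (du : coord -> point -> R)
    (t x y : R) :
  (forall p, 0 < fst p -> D p) -> C1_on D u du -> 0 < t ->
  is_derive (fun s => u (s, (x, y))) t (du T (t, (x, y))) /\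
  is_derive (fun s => u (t, (s, y))) x (du X (t, (x, y))) /\
  is_derive (fun s => u (t, (x, s))) y (du Y (t, (x, y))).
Proof.
  intros HD [_ Hu] Ht.
  assert (Hp : forall i, is_partial_within D i u (t, (x, y)) (du i (t, (x, y)))).
  { intros i. apply (Hu i), HD, Ht. }
  split; [|split].
  - apply (is_derive_of_shifted (fun h => D (shift T (t, (x, y)) h))
             (fun h => u (shift T (t, (x, y)) h))); [reflexivity| |apply (Hp T)].
    exists (mkposreal t Ht). intros h Hh. change (Rabs (h - 0) < t) in Hh.
    apply Rabs_def2 in Hh. apply HD. change (0 < t + h). lra.
  - apply (is_derive_of_shifted (fun h => D (shift X (t, (x, y)) h))
             (fun h => u (shift X (t, (x, y)) h))); [reflexivity| |apply (Hp X)].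
    apply filter_forall. intros h. apply HD, Ht.
  - apply (is_derive_of_shifted (fun h => D (shift Y (t, (x, y)) h))
             (fun h => u (shift Y (t, (x, y)) h))); [reflexivity| |apply (Hp Y)].
    apply filter_forall. intros h. apply HD, Ht.
Qed.

Lemma filterlim_axis (D : R -> Prop) (F : point -> R) (t x : R) :
  continuous_on (fun p : point => D (fst p)) F -> D t ->
  filterlim (fun z : R * R => F (fst z, (snd z, 0)))
    (within (fun z => D (fst z)) (locally (t, x))) (locally (F (t, (x, 0)))).
Proof.
  intros HF Ht. apply filterlim_locally. intros eps.
  assert (H := proj1 (filterlim_locally _ _) (HF (t, (x, 0)) Ht) eps).
  destruct H as [d Hd]. exists d. intros [s y] [Hs Hy] Ds.
  apply (Hd (s, (y, 0))); [|exact Ds].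
  split; [exact Hs|]. split; [exact Hy|]. apply ball_center.
Qed.

Lemma continuity_2d_axis (F : point -> R) (t x : R) :
  continuous_on (fun p : point => 0 < fst p) F -> 0 < t ->
  continuity_2d_pt (fun s y => F (s, (y, 0))) t x.
Proof.
  intros HF Ht. apply continuity_2d_pt_filterlim.
  apply (filterlim_filter_le_1 (F := within (fun z : R * R => 0 < fst z) (locally (t, x)))).
  - intros P [d Hd]. exists (mkposreal _ (Rmin_pos d t (cond_pos d) Ht)).
    intros [s y] [Hs Hy].
    change (Rabs (s - t) < Rmin d t) in Hs. change (Rabs (y - x) < Rmin d t) in Hy.
    pose proof (Rmin_l d t). pose proof (Rmin_r d t).
    apply Hd.
    + split; apply ball_R; simpl; lra.
    + apply Rabs_def2 in Hs. simpl. lra.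
  - apply (filterlim_axis (fun s => 0 < s) F); assumption.
Qed.

Lemma is_derive_even_0 (g : R -> R) (l : R) :
  (forall x, g (- x) = g x) -> is_derive g 0 l -> l = 0.
Proof.
  intros Hev Hg.
  assert (H : is_derive g 0 (- l)).
  { apply (is_derive_ext (fun x => g (- x))); [exact Hev|].
    evar_last.
    - apply (is_derive_comp (K := R_AbsRing) (V := R_NormedModule) g Ropp).
      + rewrite Ropp_0. exact Hg.
      + auto_derive; [exact I|reflexivity].
    - unfold scal; simpl; unfold mult; simpl. ring. }
  apply is_derive_unique in H. apply is_derive_unique in Hg. lra.
Qed.

Lemma sqrt_sum_axis (x : R) : sqrt (x ^ 2 + 0 ^ 2) = Rabs x.
Proof.
  rewrite <- sqrt_Rsqr_abs. f_equal. unfold Rsqr. ring.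
Qed.

(** The functions are the derivatives in [T] and [X] of the solution on the axis
    [y = 0], negative [x] included: the Cartesian regularity then holds on both
    sides of the origin, and [q] vanishes there because the solution is even.
    Off the origin, [u_yy = q / x] comes from differentiating
    [u_y = q (t, s) y / s], [s = sqrt (x^2 + y^2)]. *)
Lemma wave_potential_acoustic (W : R -> R -> R) :
  wave_potential W ->
  exists p q pt qt : R -> R -> R,
    acoustic p q pt qt /\
    (forall r, p 0 r = - exp (- (r ^ 2 / 2)) /\ q 0 r = 0) /\
    (forall t r, 0 <= t -> 0 <= r ->
       is_derive_within (fun s => 0 <= s) (fun s => W s r) t (p t r) /\
       is_derive_within (fun s => 0 <= s) (W t) r (q t r)).
Proof.
  intros (du & ddu & Hu & Hdu & Hwave & Hf & Hg).
  set (p := fun t x => du T (t, (x, 0))).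
  set (q := fun t x => du X (t, (x, 0))).
  exists p, q, (fun t x => ddu T T (t, (x, 0))), (fun t x => ddu X T (t, (x, 0))).
  assert (Hpos1 : forall z : point, 0 < fst z -> 0 <= fst z) by (intros; lra).
  assert (Hpos2 : forall z : point, 0 < fst z -> 0 < fst z) by auto.
  assert (Pu := fun t x y => C1_on_is_derive _ _ _ t x y Hpos1 Hu).
  assert (Pdu := fun i t x y => C1_on_is_derive _ _ _ t x y Hpos2 (Hdu i)).
  assert (Hin : forall t r, 0 <= t -> 0 <= r ->
       is_derive_within (fun s => 0 <= s) (fun s => W s r) t (p t r) /\
       is_derive_within (fun s => 0 <= s) (W t) r (q t r)).
  { intros t r Ht Hr. destruct Hu as [_ Hu]. split.
    - eapply is_derive_within_translate; [exact Ht| |apply (proj2 (Hu T) (t, (r, 0)) Ht)].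
      intros s Hs. simpl. replace (t + (s - t)) with s by ring.
      split; [exact Hs|]. rewrite <- (Rabs_pos_eq r Hr) at 1. rewrite <- sqrt_sum_axis.
      reflexivity.
    - eapply is_derive_within_translate; [exact Hr| |apply (proj2 (Hu X) (t, (r, 0)) Ht)].
      intros s Hs. simpl. replace (r + (s - r)) with s by ring.
      split; [exact Ht|]. rewrite <- (Rabs_pos_eq s Hs) at 1. rewrite <- sqrt_sum_axis.
      reflexivity. }
  assert (HWr : forall t s, 0 < t -> 0 < s -> is_derive (W t) s (q t s)).
  { intros t s Ht Hs.
    apply (is_derive_ext_loc (fun y => radial W (t, (y, 0)))).
    - apply (filter_imp (fun y => 0 < y)); [|apply locally_pos, Hs].
      intros y Hy. simpl. change (y * (y * 1) + 0 * (0 * 1)) with (y ^ 2 + 0 ^ 2).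
      rewrite sqrt_sum_axis, Rabs_pos_eq by lra. reflexivity.
    - apply (Pu t s 0 Ht). }
  assert (Hq0 : forall t, 0 < t -> q t 0 = 0).
  { intros t Ht. apply (is_derive_even_0 (fun y => radial W (t, (y, 0)))).
    - intros y. simpl. do 2 f_equal. ring.
    - apply (Pu t 0 0 Ht). }
  assert (HYY : forall t x, 0 < t -> 0 < x -> ddu Y Y (t, (x, 0)) = q t x / x).
  { intros t x Ht Hx.
    assert (Hsq : forall y, 0 < sqrt (x ^ 2 + y ^ 2)).
    { intros y. apply sqrt_lt_R0. nra. }
    assert (HduY : forall y, du Y (t, (x, y))
              = q t (sqrt (x ^ 2 + y ^ 2)) * (y / sqrt (x ^ 2 + y ^ 2))).
    { intros y.
      assert (H1 : is_derive (fun z => radial W (t, (x, z))) y (du Y (t, (x, y)))).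
      { apply (Pu t x y Ht). }
      rewrite <- (is_derive_unique _ _ _ H1). apply is_derive_unique.
      evar_last.
      - apply (is_derive_comp (K := R_AbsRing) (V := R_NormedModule) (W t)
                 (fun z => sqrt (x ^ 2 + z ^ 2))).
        + apply HWr; [exact Ht|apply Hsq].
        + auto_derive; [|reflexivity]. pose proof (Hsq y). nra.
      - unfold scal; simpl; unfold mult; simpl.
        specialize (Hsq y). simpl in Hsq. field. lra. }
    assert (H1 : is_derive (fun z => du Y (t, (x, z))) 0 (ddu Y Y (t, (x, 0)))).
    { apply (Pdu Y t x 0 Ht). }
    rewrite <- (is_derive_unique _ _ _ H1). apply is_derive_unique.
    (* at [y = 0] only the derivative of the factor [y] survives *)
    apply (is_derive_ext (fun y => q t (sqrt (x ^ 2 + y ^ 2)) * (y / sqrt (x ^ 2 + y ^ 2)))).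
    { intros y. symmetry. apply HduY. }
    assert (Hqx : ex_derive (q t) x).
    { eexists. apply (Pdu X t x 0 Ht). }
    assert (Hx0 : sqrt (x ^ 2 + 0 ^ 2) = x) by (rewrite sqrt_sum_axis; apply Rabs_pos_eq; lra).
    evar_last.
    - apply (is_derive_mult (fun y => q t (sqrt (x ^ 2 + y ^ 2)))
               (fun y => y / sqrt (x ^ 2 + y ^ 2))).
      + apply (is_derive_comp (K := R_AbsRing) (V := R_NormedModule) (q t)
                 (fun z => sqrt (x ^ 2 + z ^ 2)) 0 (Derive (q t) x)).
        * rewrite Hx0. apply Derive_correct, Hqx.
        * auto_derive; [|reflexivity]. nra.
      + auto_derive; [|reflexivity].
        pose proof (Hsq 0) as H. simpl in H. repeat split; nra.
      + intros; apply Rmult_comm.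
    - unfold scal, plus; simpl; unfold mult; simpl. unfold mult; simpl.
      change (x * (x * 1) + 0 * (0 * 1)) with (x ^ 2 + 0 ^ 2). rewrite Hx0. field. lra. }
  assert (HSchwarz : forall t x, 0 < t -> ddu T X (t, (x, 0)) = ddu X T (t, (x, 0))).
  { intros t x Ht.
    set (f := fun s y => radial W (s, (y, 0))).
    assert (Dx : forall s y, 0 < s -> Derive (fun z => f s z) y = q s y).
    { intros s y Hs. apply is_derive_unique, (Pu s y 0 Hs). }
    assert (Dt : forall s y, 0 < s -> Derive (fun z => f z y) s = p s y).
    { intros s y Hs. apply is_derive_unique, (Pu s y 0 Hs). }
    assert (Dtx : forall s y, 0 < s ->
              is_derive (fun z => Derive (fun w => f z w) y) s (ddu X T (s, (y, 0)))).
    { intros s y Hs. apply (is_derive_ext_loc (fun z => q z y)).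
      - apply (filter_imp (fun z => 0 < z)); [|apply locally_pos, Hs].
        intros z Hz. symmetry. apply Dx, Hz.
      - apply (Pdu X s y 0 Hs). }
    assert (Dxt : forall s y, 0 < s ->
              is_derive (fun z => Derive (fun w => f w z) s) y (ddu T X (s, (y, 0)))).
    { intros s y Hs. apply (is_derive_ext (fun z => p s z)).
      - intros z. symmetry. apply Dt, Hs.
      - apply (Pdu T s y 0 Hs). }
    assert (Hloc : forall P : R -> R -> Prop,
              (forall s y, 0 < s -> P s y) -> locally_2d P t x).
    { intros P HP. exists (mkposreal t Ht). intros s y Hs _. simpl in Hs.
      apply Rabs_def2 in Hs. apply HP. lra. }
    eapply eq_trans; [symmetry; exact (is_derive_unique _ _ _ (Dxt t x Ht))|].
    eapply eq_trans; [|exact (is_derive_unique _ _ _ (Dtx t x Ht))].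
    symmetry. apply (Schwarz f t x).
    - apply Hloc. intros s y Hs. repeat split.
      + eexists. apply (Pu s y 0 Hs).
      + eexists. apply (Pu s y 0 Hs).
      + eexists. apply Dtx, Hs.
      + eexists. apply Dxt, Hs.
    - apply continuity_2d_pt_ext_loc with (fun s y => ddu X T (s, (y, 0))).
      + apply Hloc. intros s y Hs. symmetry. apply is_derive_unique, Dtx, Hs.
      + apply continuity_2d_axis; [apply (Hdu X)|exact Ht].
    - apply continuity_2d_pt_ext_loc with (fun s y => ddu T X (s, (y, 0))).
      + apply Hloc. intros s y Hs. symmetry. apply is_derive_unique, Dxt, Hs.
      + apply continuity_2d_axis; [apply (Hdu T)|exact Ht]. }
  split; [|split; [|exact Hin]].
  - split.
    + intros [t x] Ht. apply (filterlim_axis (fun s => 0 <= s) (du T)); [apply Hu|exact Ht].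
    + intros [t x] Ht. apply (filterlim_axis (fun s => 0 <= s) (du X)); [apply Hu|exact Ht].
    + intros t x Ht. apply continuity_2d_axis; [apply (Hdu T)|exact Ht].
    + intros t x Ht. apply continuity_2d_axis; [apply (Hdu X)|exact Ht].
    + intros t x Ht. apply (Pdu T t x 0 Ht).
    + intros t x Ht. apply (Pdu X t x 0 Ht).
    + intros t x Ht. rewrite <- HSchwarz by exact Ht. apply (Pdu T t x 0 Ht).
    + intros t x Ht Hx. evar_last.
      * apply (is_derive_mult (fun y => y) (q t));
          [apply (is_derive_id (K := R_AbsRing))|apply (Pdu X t x 0 Ht)
          |intros; apply Rmult_comm].
      * unfold plus, mult, one; simpl. unfold one; simpl.
        destruct Hx as [Hx|<-]; [|rewrite Hq0 by exact Ht; ring].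
        rewrite Hwave, HYY by assumption. field. lra.
  - intros r. split.
    + unfold p. rewrite Hg. do 4 f_equal. ring.
    + unfold q. destruct Hu as [_ Hu].
      assert (H1 : is_derive (fun y => radial W (0, (y, 0))) r (du X (0, (r, 0)))).
      { eapply is_derive_of_shifted; [| |apply (proj2 (Hu X) (0, (r, 0)) (Rle_refl 0))].
        - reflexivity.
        - apply filter_forall. intros h. simpl. apply Rle_refl. }
      rewrite <- (is_derive_unique _ _ _ H1). apply is_derive_unique.
      apply (is_derive_ext (fun _ => 0)); [intros y; symmetry; apply Hf|].
      apply (is_derive_const (K := R_AbsRing) (V := R_NormedModule)).
Qed.

Theorem lemma6 (W : R -> R -> R) (hW : wave_potential W)
    (t r : R) (ht : 0 <= t) (hr : 0 <= r) :
  is_pressure_pulsation W t r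
    (J 0 1 t r - t ^ 2 * J 0 3 t r + r * t * J 1 2 t r) /\
  is_radial_velocity_pulsation W t r
    (- t ^ 2 * J 1 2 t r + r * t * J 0 1 t r).
Proof.
  destruct (wave_potential_acoustic W hW) as (p & q & pt & qt & Hac & H0 & HW).
  destruct (acoustic_unique _ _ _ _ _ _ _ _ Hac acoustic_wave) with (t := t) (x := r)
    as [Ep Eq]; [|assumption|assumption|].
  - intros x _. destruct (H0 x) as [Hp Hq]. rewrite Hp, Hq.
    unfold wave_t, wave_r_over_r. rewrite arc_int_0_1_0. split; field.
  - destruct (HW t r ht hr) as [Hp Hq]. rewrite !J_arc_int. simpl Nat.add.
    split.
    + unfold is_pressure_pulsation. evar_last; [exact Hp|].
      rewrite Ep. unfold wave_t. field.
    + unfold is_radial_velocity_pulsation. evar_last; [exact Hq|].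
      rewrite Eq. unfold wave_r_over_r. field.
Qed.
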